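(* Let $K$ be a differential field of characteristic zero and let $R=K\{x_1,\ldots,x_n\}$. Let $P\subset R$ be a prime differential ideal with characteristic set $(A_1,\ldots,A_n)$ (of length exactly $n$) with respect to some ranking $\prec$. Then $$\operatorname{trdeg}_K(R/P)=J(A_1,\ldots,A_n).$$ In particular $\operatorname{trdeg}_K(R/P)<\infty$.
   Context: $R=K\{x_1,\ldots,x_n\}=K[x_i^{(r)}: 1\le i\le n,\ r\ge 0]$ is the ring of differential polynomials, with derivation $\partial$ extending that of $K$ and $\partial x_i^{(r)}=x_i^{(r+1)}$. A differential ideal is an ideal closed under $\partial$. $\operatorname{trdeg}_K(R/P)$ is the (ordinary) transcendence degree over $K$ of $\operatorname{Frac}(R/P)$. Order: $\operatorname{ord}^{\partial}_{x_j}(u)=\max\big(\{0\}\cup\{r\in\mathbb{Z}_{\ge 0}:\ \partial u/\partial x_j^{(r)}\ne 0\}\big)$. Jacobi number: $J(u_1,\ldots,u_n)=\max_{\sigma\in S_n}\sum_{i=1}^n\operatorname{ord}^{\partial}_{x_i}(u_{\sigma(i)})$. Ranking: a total order $\prec$ on the set $\{x_i^{(j)}:1\le i\le n,\ j\ge 0\}$ such that $u\prec v$ implies $\partial u\prec\partial v$, and $u\prec\partial u$ for all $u$. For $A\in R\setminus K$, the leader $\ell_A$ is the $\prec$-largest variable $x_i^{(j)}$ occurring in $A$, and the rank of $A$ is $\ell_A^{d_A}$ with $d_A=\deg_{\ell_A}(A)$; ranks are compared first by leader, then by degree. $B$ is reduced with respect to $A$ if no proper derivative $\partial^k\ell_A$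 ($k\ge1$) of $\ell_A$ occurs in $B$ and $\deg_{\ell_A}(B)<\deg_{\ell_A}(A)$. A sequence $(A_1,\ldots,A_r)$ of elements of $R\setminus K$, listed in increasing order of leaders, is autoreduced if each $A_i$ is reduced with respect to every $A_j$, $j\ne i$. Autoreduced sequences are compared as follows: $(A_1,\ldots,A_r)$ is lower than $(B_1,\ldots,B_s)$ if either there is an $i\le\min(r,s)$ such that $A_j$ and $B_j$ have the same rank for $j<i$ and $A_i$ has lower rank than $B_i$, or $r>s$ and $A_j$, $B_j$ have the same rank for all $j\le s$. A characteristic set (or characteristic sequence) of an ideal is an autoreduced sequence of elements of that ideal that is minimal for this comparison. *)

(* Defs.v *)
From HB Require Import structures.
From mathcomp Require Import all_boot all_order all_algebra.
From mathcomp Require Import perm finmap boolp.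
From mathcomp Require Import -(notations) mpoly.
From mathcomp Require Import monalg.

Set Implicit Arguments.
Unset Strict Implicit.
Unset Printing Implicit Defensive.

Import GRing.Theory.
Local Open Scope fset_scope.
Local Open Scope ring_scope.
Local Open Scope quotient_scope.

(* The quotient library gives R / P only a commutative ring structure, since  *)
(* inverses in R / P need not be computable; boolp provides them. Likewise a  *)
(* boolean membership predicate for P is no restriction: by boolp every       *)
(* subset of R has one.                                                       *)
Section PrimeQuotient.
Variables (R : comNzRingType) (P : prime_idealr R).
Local Notation Q := {ideal_quot P}.

Definition quot_unit : pred Q := fun x => `[< exists y, y * x = 1 >].

Definition quot_inv (x : Q) : Q :=
  if pselect (exists y, y * x = 1) is left h then projT1 (cid h) else x.

Lemma quot_mulVr : {in quot_unit, left_inverse 1 quot_inv *%R}.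
Proof.
move=> x /asboolP xu; rewrite /quot_inv; case: pselect => // h.
exact: projT2 (cid h).
Qed.

Lemma quot_unitP (x y : Q) : y * x = 1 -> x \in quot_unit.
Proof. by move=> yx; apply/asboolP; exists y. Qed.

Lemma quot_inv_out : {in [predC quot_unit], quot_inv =1 id}.
Proof.
move=> x; rewrite inE => xu; rewrite /quot_inv; case: pselect => // h.
by case/negP: xu; apply/asboolP.
Qed.

HB.instance Definition _ := GRing.ComNzRing_hasMulInverse.Build Q
  quot_mulVr quot_unitP quot_inv_out.
HB.instance Definition _ := GRing.ComUnitRing_isIntegral.Build Q
  (@Quotient.rquot_IdomainAxiom R P).

Definition residue_frac (f : R) : {fraction {ideal_quot P}} :=
  FracField.tofrac (\pi_Q f).

HB.instance Definition _ := GRing.RMorphism.copy residue_frac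
  (@FracField.tofrac Q \o \pi_Q).

Lemma residue_frac_eq0 (f : R) : (residue_frac f == 0) = (f \in P).
Proof.
by rewrite tofrac_eq0 -(rmorph0 (\pi_Q : {rmorphism R -> Q})) /=
  -Quotient.idealrBE subr0.
Qed.
End PrimeQuotient.

Section TranscendenceDegree.
Variables (K F : fieldType) (iota : {rmorphism K -> F}).

Definition alg_indep (m : nat) (s : 'I_m -> F) : Prop :=
  forall p : mpoly.mpoly m K, mpoly.mmap iota s p = 0 -> p = 0.

(* The largest size of an algebraically independent family.                   *)
Definition is_trdeg (d : nat) : Prop :=
  (exists s : 'I_d -> F, alg_indep s) /\
  (forall (m : nat) (s : 'I_m -> F), alg_indep s -> (m <= d)%N).

(* None stands for an infinite transcendence degree. *)
Definition trdeg : option nat :=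
  if pselect (exists d, is_trdeg d) is left h then Some (projT1 (cid h))
  else None.

Lemma trdegP (d : nat) : trdeg = Some d <-> is_trdeg d.
Proof.
rewrite /trdeg; case: pselect => [h|h]; last by split=> // hd; case: h; exists d.
case: (cid h) => e /= [[s hs] he]; split=> [[<-]|[[t ht] hd]].
  by split=> //; exists s.
by congr Some; apply/eqP; rewrite eqn_leq (hd _ _ hs) (he _ _ ht).
Qed.

Lemma alg_indep0 (s : 'I_0 -> F) : alg_indep s.
Proof.
move=> p; have -> : p = mpoly.mpolyC 0 (mpoly.mcoeff mpoly.mnm0 p).
  apply/mpoly.mpolyP => m; rewrite mpoly.mcoeffC.
  have -> : m = mpoly.mnm0 by apply/mpoly.mnmP; case.
  by rewrite eqxx mulr1.
rewrite mpoly.mmapC => /eqP; rewrite fmorph_eq0 => /eqP ->.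
exact: mpoly.mpolyC0.
Qed.

Lemma trdeg_None : trdeg = None <->
  forall d, exists m (s : 'I_m -> F), (d < m)%N /\ alg_indep s.
Proof.
split=> [tN d|inf].
  apply: contrapT => hd.
  have ub m (s : 'I_m -> F) : alg_indep s -> (m <= d)%N.
    by move=> hs; rewrite leqNgt; apply/negP => dm; apply: hd; exists m, s.
  have ex0 : exists m, `[< exists s : 'I_m -> F, alg_indep s >].
    by exists 0%N; apply/asboolP; exists (fun=> 0); exact: alg_indep0.
  have bd m : `[< exists s : 'I_m -> F, alg_indep s >] -> (m <= d)%N.
    by move=> /asboolP [s]; exact: ub.
  case: (ex_maxnP ex0 bd) => e /asboolP es emax.
  suff /trdegP : is_trdeg e by rewrite tN.
  by split=> // m s hs; apply: emax; apply/asboolP; exists s.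
case tE: trdeg => [d|] //; case/trdegP: tE => _ ub.
by have [m [s [dm /ub]]] := inf d; rewrite leqNgt dm.
Qed.
End TranscendenceDegree.

Definition derivation (A : nzRingType) (D : A -> A) : Prop :=
  (forall a b, D (a + b) = D a + D b) /\
  (forall a b, D (a * b) = D a * b + a * D b).

(* The pair (i, r) encodes the variable x_i^(r). *)
Definition dvar (n : nat) : choiceType := ('I_n * nat)%type.

(* K{x_1, ..., x_n}, as polynomials in the infinitely many x_i^(r). *)
Notation "{ 'dpoly' K [ n ] }" := {malg K[{cmonom (dvar n)}]}
  (at level 0, K, n at level 2, format "{ 'dpoly'  K [ n ] }") : type_scope.

Section DifferentialPolynomials.
Variables (K : fieldType) (n : nat).
Local Notation R := {dpoly K[n]}.
Implicit Types (f g : R) (v w : dvar n) (m : {cmonom (dvar n)}).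

Definition dconst : K -> R := @malgC {cmonom (dvar n)} K.

HB.instance Definition _ := GRing.RMorphism.on dconst.

Definition dX v : R := << ucm v >>.

Definition vder (k : nat) v : dvar n := (v.1, (v.2 + k)%N).

Definition dvars f : {fset dvar n} := \bigcup_(m <- msupp f) finsupp m.

Definition degv v f : nat := \max_(m <- msupp f) m v.

Definition pderiv v f : R :=
  \sum_(m <- msupp f) dconst f@_m * (<< divcm m (ucm v) >> *+ m v).

Definition coefder (delta : K -> K) f : R :=
  \sum_(m <- msupp f) << delta f@_m *g m >>.

(* The unique derivation that extends delta and maps x_i^(r) to x_i^(r+1):     *)
(* see dder_derivation, dder_const and dder_dX.                               *)
Definition dder (delta : K -> K) f : R :=
  coefder delta f + \sum_(v <- dvars f) pderiv v f * dX (vder 1 v).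

Definition dord (j : 'I_n) f : nat :=
  \max_(v <- dvars f | (v.1 == j) && (pderiv v f != 0)) v.2.

Lemma dvarsP v f :
  reflect (exists2 m, m \in msupp f & v \in finsupp m) (v \in dvars f).
Proof.
apply: (iffP (bigfcupP _ _ _ _)) => [[m /andP[mf _] vm]|[m mf vm]].
  by exists m.
by exists m => //; rewrite mf.
Qed.

Lemma dvarsC_eq0 f : dvars f = fset0 <-> exists c, f = dconst c.
Proof.
split=> [f0|[c ->]].
  exists f@_mone; apply/malgP => m; rewrite mcoeffC.
  have [<-|m1] := eqVneq; first by [].
  apply/eqP; rewrite mcoeff_eq0; apply: contra m1 => mf.
  apply/cmP => v; rewrite cm1; apply/eqP; rewrite cmE_eq0.
  by apply/negP => vm; have: v \in dvars f by [apply/dvarsP; exists m]; rewrite f0.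
apply/fsetP => v; rewrite in_fset0; apply/dvarsP => -[m].
by move=> /(fsubsetP (msuppC_le c)); rewrite in_fset1 => /eqP ->; rewrite mdom1.
Qed.

Lemma pderiv_mmap v : pderiv v =1
  mmap (@malgC _ K) (fun m => (<< divcm m (ucm v) >> *+ m v : R)).
Proof. by []. Qed.

Lemma pderivD v : {morph pderiv v : f g / f + g}.
Proof. by move=> f g; rewrite !pderiv_mmap raddfD. Qed.

Lemma pderivU v c m : pderiv v << c *g m >> = << c *+ m v *g divcm m (ucm v) >>.
Proof.
rewrite pderiv_mmap mmapU mulrnAr malgM_def fgmulUU mulr1 mul1m.
exact/esym/monalgUMn.
Qed.

Lemma pderiv_dX v w : pderiv v (dX w) = (w == v)%:R.
Proof.
rewrite pderivU cmU; case: eqP => [->|_]; last exact: monalgU0.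
suff -> : divcm (ucm v) (ucm v) = mone by [].
by apply/eqP/cmP => k; rewrite divcmE subnn cm1.
Qed.

Lemma monalgM c d m m' :
  << c *g m >> * << d *g m' >> = << c * d *g mmul m m' >> :> R.
Proof. exact: fgmulUU. Qed.

Lemma leibnizU (D : R -> R) : {morph D : f g / f + g} ->
  (forall c d m m', D << c * d *g mmul m m' >> =
     D << c *g m >> * << d *g m' >> + << c *g m >> * D << d *g m' >>) ->
  forall f g, D (f * g) = D f * g + f * D g.
Proof.
move=> DD DU f g.
have D0 : D 0 = 0 by apply: (addrI (D 0)); rewrite -DD !addr0.
have Dsum (I : Type) (r : seq I) (F : I -> R) :
    D (\sum_(i <- r) F i) = \sum_(i <- r) D (F i).
  by apply: (big_morph D DD D0).
have {DU} DU c m g' : D (<< c *g m >> * g') =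
    D << c *g m >> * g' + << c *g m >> * D g'.
  rewrite (monalgE g') mulr_sumr !Dsum !mulr_sumr -big_split /=.
  apply: eq_bigr => m' _; apply: etrans (DU _ _ _ _); congr (D _).
  exact: monalgM.
rewrite (monalgE f) mulr_suml !Dsum !mulr_suml -big_split /=.
apply: eq_bigr => m _; exact: DU.
Qed.

Lemma divcmMr v m m' : (0 < m' v)%N ->
  divcm (mmul m m') (ucm v) = mmul m (divcm m' (ucm v)).
Proof.
move=> m'v; apply/eqP/cmP => k; rewrite cmM !divcmE cmM ucmE.
by case: eqP => [<-|_]; [rewrite addnBA | rewrite !subn0].
Qed.

Lemma pderivM v f g : pderiv v (f * g) = pderiv v f * g + f * pderiv v g.
Proof.
apply: leibnizU => [|c d p q]; first exact: pderivD.
have -> : pderiv v << c *g p >> * << d *g q >> =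
    << c * d *+ p v *g mmul (divcm p (ucm v)) q >>.
  by rewrite pderivU -mulrnAl; exact: monalgM.
have -> : << c *g p >> * pderiv v << d *g q >> =
    << c * d *+ q v *g mmul p (divcm q (ucm v)) >>.
  by rewrite pderivU -mulrnAr; exact: monalgM.
rewrite pderivU [mmul p q v]cmM mulrnDr [LHS]monalgUD.
apply: (congr2 +%R).
  have [p0|p0] := posnP (p v).
    by rewrite p0 mulr0n !monalgU0.
  by rewrite (mulmC p) (divcmMr _ p0) (mulmC q).
have [q0|q0] := posnP (q v).
  by rewrite q0 mulr0n !monalgU0.
by rewrite (divcmMr _ q0).
Qed.

Lemma pderiv_out v f : v \notin dvars f -> pderiv v f = 0.
Proof.
move=> vf; rewrite /pderiv big_seq big1 // => m mf.
suff /eqP -> : m v == 0%N by rewrite mulr0n mulr0.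
by rewrite cmE_eq0; apply: contra vf => vm; apply/dvarsP; exists m.
Qed.

Lemma dder_widen delta (d : {fset dvar n}) f : dvars f `<=` d ->
  dder delta f = coefder delta f + \sum_(v <- d) pderiv v f * dX (vder 1 v).
Proof.
move=> fd; congr (_ + _); apply: (big_fset_incl _ fd) => v _ vf.
by rewrite pderiv_out // mul0r.
Qed.

Section Derivation.
Variables (delta : K -> K) (deltaP : derivation delta).

Lemma delta0 : delta 0 = 0.
Proof. by apply: (addrI (delta 0)); rewrite -deltaP.1 !addr0. Qed.

Lemma delta1 : delta 1 = 0.
Proof.
apply: (addrI (delta 1)); rewrite addr0.
by rewrite -[in RHS](mulr1 1) deltaP.2 mulr1 mul1r.
Qed.

Lemma coefderE (d : {fset {cmonom (dvar n)}}) f : msupp f `<=` d ->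
  coefder delta f = \sum_(m <- d) << delta f@_m *g m >>.
Proof.
move=> fd; apply: (big_fset_incl _ fd) => m _ /mcoeff_outdom ->.
by rewrite delta0 monalgU0.
Qed.

Lemma coefderU c m : coefder delta << c *g m >> = << delta c *g m >>.
Proof. by rewrite (coefderE msuppU_le) big_seq_fset1 mcoeffUU. Qed.

Lemma coefderD : {morph coefder delta : f g / f + g}.
Proof.
move=> f g; pose d := msupp f `|` msupp g.
rewrite !(@coefderE d) ?fsubsetUl ?fsubsetUr ?msuppD_le // -big_split /=.
by apply: eq_bigr => m _; rewrite mcoeffD deltaP.1 monalgUD.
Qed.

Lemma coefderM f g :
  coefder delta (f * g) = coefder delta f * g + f * coefder delta g.
Proof.
apply: leibnizU => [|c d p q]; first exact: coefderD.
have -> : coefder delta << c *g p >> * << d *g q >> =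
    << delta c * d *g mmul p q >>.
  by rewrite coefderU; exact: monalgM.
have -> : << c *g p >> * coefder delta << d *g q >> =
    << c * delta d *g mmul p q >>.
  by rewrite coefderU; exact: monalgM.
by apply: etrans (coefderU _ _) _; rewrite (deltaP.2 c d); exact: monalgUD.
Qed.

Lemma dder_derivation : derivation (dder delta).
Proof.
split=> f g.
  pose d := dvars f `|` dvars g `|` dvars (f + g).
  have fd : dvars f `<=` d by rewrite /d -fsetUA fsubsetUl.
  have gd : dvars g `<=` d by rewrite /d fsetUAC fsubsetUr.
  rewrite (dder_widen delta fd) (dder_widen delta gd).
  apply: etrans (dder_widen delta (fsubsetUr _ _ : _ `<=` d)) _.
  apply: etrans _ (addrACA _ _ _ _).
  apply: (congr2 +%R); first exact: coefderD.
  rewrite -big_split /=; apply: eq_bigr => v _.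
  by rewrite pderivD; exact: mulrDl.
pose d := dvars f `|` dvars g `|` dvars (f * g).
have fd : dvars f `<=` d by rewrite /d -fsetUA fsubsetUl.
have gd : dvars g `<=` d by rewrite /d fsetUAC fsubsetUr.
rewrite (dder_widen delta fd) (dder_widen delta gd).
apply: etrans (dder_widen delta (fsubsetUr _ _ : _ `<=` d)) _.
apply: etrans _ (esym (congr2 +%R (mulrDl _ _ _) (mulrDr _ _ _))).
apply: etrans _ (addrACA _ _ _ _).
apply: (congr2 +%R); first exact: coefderM.
rewrite mulr_suml mulr_sumr -big_split /=; apply: eq_bigr => v _.
rewrite pderivM; apply: etrans (mulrDl _ _ _) _.
by apply: (congr2 +%R); [exact: mulrAC | exact/esym/mulrA].
Qed.

Lemma dder_const c : dder delta (dconst c) = dconst (delta c).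
Proof.
rewrite /dder; have /dvarsC_eq0 -> : exists c', dconst c = dconst c' by exists c.
by rewrite big_seq_fset0 addr0 coefderU.
Qed.

Lemma dder_dX v : dder delta (dX v) = dX (vder 1 v).
Proof.
have dv : dvars (dX v) `<=` [fset v].
  apply/fsubsetP => w /dvarsP [m /(fsubsetP msuppU_le)].
  by rewrite in_fset1 => /eqP ->; rewrite mdomU.
rewrite (dder_widen _ dv) big_seq_fset1 pderiv_dX eqxx mul1r.
by rewrite coefderU delta1 monalgU0 add0r.
Qed.
End Derivation.

(* dord takes a maximum over the variables occurring in f; no other x_j^(r)    *)
(* can have a nonzero partial derivative.                                     *)
Lemma dord_ge (j : 'I_n) (r : nat) f :
  pderiv ((j, r) : dvar n) f != 0 -> (r <= dord j f)%N.
Proof.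
move=> pf; have jf : ((j, r) : dvar n) \in dvars f.
  by apply: contraR pf => /pderiv_out ->.
have := @leq_bigmax_seq _ _ (fun v : dvar n => (v.1 == j) && (pderiv v f != 0))
  (fun v => v.2) _ jf.
by apply; rewrite eqxx.
Qed.

Definition jacobi (u : 'I_n -> R) : nat :=
  \max_(s : 'S_n) \sum_(i < n) dord i (u (s i)).

Definition differential_ideal (delta : K -> K) (P : {pred R}) : Prop :=
  forall f, f \in P -> dder delta f \in P.

Record ranking (lt : rel (dvar n)) : Prop := Ranking {
  ranking_irr : irreflexive lt;
  ranking_trans : transitive lt;
  ranking_total : forall v w, v != w -> lt v w || lt w v;
  ranking_vder : forall v w, lt v w -> lt (vder 1 v) (vder 1 w);
  ranking_lt_vder : forall v, lt v (vder 1 v)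
}.

Section Ranking.
Variable lt : rel (dvar n).

(* None exactly when f is in K, see leader_None. *)
Definition leader f : option (dvar n) :=
  ohead [seq v <- dvars f | all (fun w => (w == v) || lt w v) (dvars f)].

Definition rank f : option (dvar n * nat) :=
  omap (fun l => (l, degv l f)) (leader f).

Definition leader_lt f g : bool :=
  if (leader f, leader g) is (Some v, Some w) then lt v w else false.

Definition rank_lt f g : bool :=
  if (rank f, rank g) is (Some (v, d), Some (w, e)) then
    lt v w || ((v == w) && (d < e)%N)
  else false.

(* reduced g f means that g is reduced with respect to f. *)
Definition reduced g f : Prop :=
  if leader f is Some l then
    (forall k, (0 < k)%N -> vder k l \notin dvars g) /\
    (degv l g < degv l f)%N
  else False.

Definition autoreduced (A : seq R) : Prop :=
  [/\ forall f, f \in A -> ~ exists c, f = dconst c,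
      pairwise leader_lt A
    & forall i j, (i < size A)%N -> (j < size A)%N -> i != j ->
        reduced A`_i A`_j].

Definition lower (A B : seq R) : Prop :=
  (exists i, [/\ (i < minn (size A) (size B))%N,
                 forall j, (j < i)%N -> rank A`_j = rank B`_j
               & rank_lt A`_i B`_i]) \/
  ((size B < size A)%N /\
   forall j, (j < size B)%N -> rank A`_j = rank B`_j).

Definition characteristic_set (P : {pred R}) (A : seq R) : Prop :=
  [/\ autoreduced A, {subset A <= P}
    & forall B, autoreduced B -> {subset B <= P} -> ~ lower B A].

Hypothesis ltP : ranking lt.

Lemma leaderP f l : leader f = Some l <->
  l \in dvars f /\ forall w, w \in dvars f -> w = l \/ lt w l.
Proof.
rewrite /leader; set p := fun v => all _ _.
have pP v : reflect (forall w, w \in dvars f -> w = v \/ lt w v) (p v).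
  by apply: (iffP allP) => h w /h; [case/predU1P; [left | right] | case=> [->|->];
    rewrite ?eqxx ?orbT].
split=> [|[lf lmax]].
  case E: [seq v <- dvars f | p v] => [//|v s] [<-].
  have: v \in [seq v <- dvars f | p v] by rewrite E mem_head.
  by rewrite mem_filter => /andP[/pP pv vf].
case E: [seq v <- dvars f | p v] => [|v s] /=.
  have: l \in [seq v <- dvars f | p v] by rewrite mem_filter lf andbT; apply/pP.
  by rewrite E.
have: v \in [seq v <- dvars f | p v] by rewrite E mem_head.
rewrite mem_filter => /andP[/pP pv vf]; congr Some.
have [//|lv] := lmax _ vf; have [//|vl] := pv _ lf.
by have := ranking_trans ltP lv vl; rewrite (ranking_irr ltP).
Qed.

Lemma leader_None f : leader f = None <-> exists c, f = dconst c.
Proof.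
rewrite -dvarsC_eq0; split=> [fN|f0]; last by rewrite /leader f0.
suff: forall s : seq (dvar n), s != [::] ->
    exists2 l, l \in s & forall w, w \in s -> w = l \/ lt w l.
  move=> /(_ (dvars f)) smax; apply/eqP; apply: contraPT fN => f0.
  have [|l lf lmax] := smax.
    by rewrite -size_eq0; move: f0; rewrite -cardfs_eq0.
  by rewrite (leaderP f l).2.
elim=> [//|v [|v' s] IH] _.
  by exists v; rewrite ?mem_head // => w; rewrite inE => /eqP ->; left.
have [//|l ls lmax] := IH; have [vl|vl] := eqVneq v l.
  by exists l => [|w]; rewrite inE ?ls ?orbT // => /predU1P[->|/lmax]; [left|].
case/orP: (ranking_total ltP vl) => [lvl|llv].
  by exists l => [|w]; rewrite inE ?ls ?orbT // => /predU1P[->|/lmax]; [right|].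
exists v => [|w]; rewrite ?mem_head // inE => /predU1P[->|/lmax]; first by left.
by case=> [->|wl]; right=> //; exact: (ranking_trans ltP wl llv).
Qed.
End Ranking.
End DifferentialPolynomials.

Arguments dconst {K n}.

(* Main.v *)
Require Import Defs.
From HB Require Import structures.
From mathcomp Require Import all_boot all_order all_algebra.
From mathcomp Require Import perm finmap boolp.
From mathcomp Require Import -(notations) mpoly.
From mathcomp Require Import monalg.

(** Let l_i = x_(t i)^(r_i) be the leader of A_i. Since the A_i are mutually
    reduced, no two leaders lie in the same row {x_j^(r) : r >= 0}, so with n
    of them t is a permutation: every row contains exactly one leader, and the
    variables that are neither leaders nor derivatives of one (the low
    variables x_(t i)^(s) with s < r_i) are r_1 + ... + r_n in number. The
    proof shows that both sides of the equality are this number.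

    Jacobi number ([jacobi_staircase]). Reducedness also says that no A_i
    contains a variable of the row t j of order above r_j. So column t j of the
    order matrix is bounded by r_j, and in characteristic zero this bound is
    reached by A_j. Hence every permutation gives a sum at most
    r_1 + ... + r_n, and the one matching each row with its leader attains it.

    Transcendence degree ([trdeg_staircase]). The residues of the low
    variables form a transcendence basis of Frac(R/P).

    They are independent ([low_vars_indep]) because a nonzero polynomial in
    the low variables is reduced with respect to all the A_i, and P contains
    no nonzero element of that kind ([reduced_mem_eq0]): such an element,
    appended to the A_i with smaller leaders, would give an autoreduced
    sequence in P lower than the characteristic set.

    They span algebraically ([low_vars_span]) by induction along the ranking,
    which is a well-order ([ranking_ind]). A variable that is not low is
    d^k l_i for some i and k. The separant S_i = dA_i/dl_i is nonzero in
    characteristic zero and reduced, hence not in P. If k = 0, then A_i, read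
    as a polynomial in l_i, is an algebraic equation for l_i over smaller
    variables, nontrivial since its derivative S_i does not vanish there
    ([acl_leader]). If k > 0, then d^k A_i = S_i * d^k l_i + T with T in
    smaller variables ([iter_dder_leader]), so d^k l_i = - T / S_i in
    Frac(R/P).

    That a spanning family of size d bounds every independent family is the
    Steinitz exchange argument ([steinitz]), carried out for the relative
    algebraic closure operator [acl] on subsets of a field. *)

Set Implicit Arguments.
Unset Strict Implicit.
Unset Printing Implicit Defensive.

Import GRing.Theory.
Local Open Scope ring_scope.

(** * Algebraic closure relative to a subset of a field *)

Section GeneratedSubfield.
Variables (F : fieldType).
Implicit Types (X Y : F -> Prop) (x y : F) (s t : seq F).

(** The subfield generated by X; as an inductive predicate its minimality is
    its induction principle. *)
Inductive gen X : F -> Prop :=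
| gen_in x : X x -> gen X x
| gen1 : gen X 1
| genB x y : gen X x -> gen X y -> gen X (x - y)
| gen_div x y : gen X x -> gen X y -> gen X (x / y).

Definition gen_pred X : {pred F} := fun x => `[< gen X x >].

Lemma gen_predP X x : reflect (gen X x) (x \in gen_pred X).
Proof. exact: asboolP. Qed.

Lemma gen_divring X : divring_closed (gen_pred X).
Proof.
split=> [|x y /gen_predP hx /gen_predP hy|x y /gen_predP hx /gen_predP hy].
- exact/gen_predP/gen1.
- exact/gen_predP/genB.
- exact/gen_predP/gen_div.
Qed.

HB.instance Definition _ X :=
  GRing.isDivringClosed.Build F (gen_pred X) (gen_divring X).

(** The generated subfield as a type, which gives access to the theory of
    integral elements over a ring morphism. *)
Record genField X := GenField { gen_val : F; _ : gen_val \in gen_pred X }.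

HB.instance Definition _ X := [isSub for @gen_val X].
HB.instance Definition _ X := [Choice of genField X by <:].
HB.instance Definition _ X :=
  [SubChoice_isSubIntegralDomain of genField X by <:].
HB.instance Definition _ X :=
  [SubIntegralDomain_isSubField of genField X by <:].

Lemma gen_mono X Y x : (forall y, X y -> gen Y y) -> gen X x -> gen Y x.
Proof.
by move=> XY; elim=> *; [exact: XY|exact: gen1|exact: genB|exact: gen_div].
Qed.

(** Coefficients in the generated subfield stay in F here, so that closures
    relative to different subsets can be compared without change of type. *)
Definition acl X x : Prop :=
  exists p : {poly F}, [/\ p != 0, forall i, gen X p`_i & root p x].

(** The link that makes closure under field operations, and transitivity, a
    consequence of the corresponding facts on integral elements. *)
Lemma aclP X x : acl X x <-> integralOver (val : genField X -> F) x.
Proof.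
rewrite -integral_algebraic; split=> [[p [p0 pX px]]|[p p0 px]]; last first.
  exists (map_poly val p); rewrite map_poly_eq0; split=> // i.
  by rewrite coef_map; apply/gen_predP/valP.
pose q : {poly genField X} :=
  \poly_(i < size p) GenField (introT (gen_predP X _) (pX i)).
have qp : map_poly val q = p.
  apply/polyP => i; rewrite coef_map coef_poly; case: ltnP => [//|pi].
  by rewrite (nth_default _ pi).
exists q; last by rewrite qp.
by move: p0; rewrite -qp map_poly_eq0.
Qed.

Lemma acl_gen X x : gen X x -> acl X x.
Proof.
move=> Xx; apply/aclP.
exact: (integral_id (val : genField X -> F)
  (GenField (introT (gen_predP X x) Xx))).
Qed.

Lemma acl_in X x : X x -> acl X x. Proof. by move/gen_in/acl_gen. Qed.

Lemma acl1 X : acl X 1. Proof. exact/acl_gen/gen1. Qed.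

Lemma aclB X x y : acl X x -> acl X y -> acl X (x - y).
Proof. by move=> /aclP hx /aclP hy; apply/aclP/integral_sub. Qed.

Lemma acl_div X x y : acl X x -> acl X y -> acl X (x / y).
Proof. by move=> /aclP hx /aclP hy; apply/aclP/integral_div. Qed.

Lemma acl0 X : acl X 0.
Proof. by rewrite -(subrr 1); apply: aclB; exact: acl1. Qed.

Lemma aclN X x : acl X x -> acl X (- x).
Proof. by move=> hx; rewrite -sub0r; apply: aclB => //; exact: acl0. Qed.

Lemma aclD X x y : acl X x -> acl X y -> acl X (x + y).
Proof. by move=> hx hy; rewrite -[y]opprK; apply: aclB => //; exact: aclN. Qed.

Lemma aclM X x y : acl X x -> acl X y -> acl X (x * y).
Proof.
move=> hx hy; rewrite -[y]invrK -[y^-1]div1r.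
by apply: acl_div => //; apply: acl_div => //; exact: acl1.
Qed.

Lemma acl_genW X Y x : (forall y, X y -> acl Y y) -> gen X x -> acl Y x.
Proof.
by move=> XY; elim=> *; [exact: XY|exact: acl1|exact: aclB|exact: acl_div].
Qed.

Lemma acl_root X (p : {poly F}) x :
  p != 0 -> (forall i, acl X p`_i) -> root p x -> acl X x.
Proof.
move=> p0 pX px; apply/aclP; apply: (integral_root p0 px).
by apply/(@integral_poly _ _ (val : genField X -> F)) => i; apply/aclP.
Qed.

Lemma acl_trans X Y x : (forall y, X y -> acl Y y) -> acl X x -> acl Y x.
Proof.
move=> XY [p [p0 pX px]]; apply: acl_root p0 _ px => i.
exact: acl_genW (pX i).
Qed.

Lemma acl_mono X Y x : (forall y, X y -> Y y) -> acl X x -> acl Y x.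
Proof. by move=> XY; apply: acl_trans => y /XY; exact: acl_in. Qed.

Section Fractions.
Variables (A : F -> Prop) (X : F -> Prop).
Hypotheses (A1 : A 1) (AB : forall x y, A x -> A y -> A (x - y)).
Hypotheses (AM : forall x y, A x -> A y -> A (x * y)).
Hypothesis XA : forall x, X x -> A x.

Lemma gen_frac x : gen X x -> exists b, [/\ A b, b != 0 & A (b * x)].
Proof.
have A0 : A 0 by rewrite -(subrr 1); exact: AB.
elim=> {x} [x /XA xA||x y _ [b [Ab b0 Ax]] _ [c [Ac c0 Ay]]|].
- by exists 1; rewrite oner_neq0 mul1r.
- by exists 1; rewrite oner_neq0 mul1r.
- exists (b * c); rewrite mulf_neq0 //; split; [exact: AM | by [] |].
  rewrite mulrBr; apply: AB; last by rewrite -mulrA; apply: AM.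
  by rewrite mulrAC; apply: AM.
move=> x y _ [b [Ab b0 Ax]] _ [c [Ac c0 Ay]].
have [->|y0] := eqVneq y 0.
  by exists 1; rewrite oner_neq0 invr0 !mulr0.
exists (b * (c * y)); rewrite !mulf_neq0 //; split; [exact: AM | by [] |].
have -> : b * (c * y) * (x / y) = c * (b * x).
  by rewrite -!mulrA [y * (x / y)]mulrCA divff // mulr1 mulrCA.
exact: AM.
Qed.

(** Clearing denominators: an algebraic equation over the field generated by X
    can be taken with coefficients in any subring A containing X. Both the
    exchange property and the comparison with polynomial independence use it,
    with A a ring of polynomial values. *)
Lemma acl_frac x : acl X x ->
  exists p : {poly F}, [/\ p != 0, forall i, A p`_i & root p x].
Proof.
case=> p [p0 pX px].
have A0 : A 0 by rewrite -(subrr 1); exact: AB.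
have [b [Ab b0 bp]] : exists b, [/\ A b, b != 0 &
    forall i, (i < size p)%N -> A (b * p`_i)].
  elim: (size p) => [|k [b [Ab b0 bp]]]; first by exists 1; rewrite oner_neq0.
  have [c [Ac c0 cp]] := gen_frac (pX k).
  exists (b * c); rewrite mulf_neq0 //; split=> [||i]; [exact: AM | by [] |].
  rewrite ltnS leq_eqVlt => /predU1P[->|/bp bi].
    by rewrite -mulrA; apply: AM.
  by rewrite mulrAC; apply: AM.
exists (b *: p); rewrite scaler_eq0 negb_or b0; split=> // [i|].
  rewrite coefZ; case: (ltnP i (size p)) => [/bp //|pi].
  by rewrite nth_default ?mulr0.
by rewrite rootZ.
Qed.
End Fractions.
End GeneratedSubfield.

(** * Steinitz exchange *)

Section Steinitz.
Variables (F : fieldType).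
Implicit Types (X Y : F -> Prop) (x y : F) (s t : seq F).

Definition ext X s : F -> Prop := fun x => X x \/ x \in s.

(** Let k be the subfield generated by X, and p(T, U) a polynomial over k with
    p(T, y) <> 0 and p(x, y) = 0. Then p(x, U) = 0 is an equation for y over
    k(x). It is nontrivial: otherwise x would be a root of each coefficient of p
    with respect to U, and these would all vanish because x is transcendental
    over k. *)
Lemma acl_exchange X x y :
  acl (ext X [:: y]) x -> ~ acl X x -> acl (ext X [:: x]) y.
Proof.
move=> xy xX.
(* the ring k[y]; its elements are the coefficients of p(T, y) *)
pose A c := exists2 a : {poly F}, forall i, gen X a`_i & a.[y] = c.
have g0 : gen X 0 by rewrite -(subrr 1); apply: genB; exact: gen1.
have gC c : gen X c -> forall i, gen X (c%:P)`_i.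
  by move=> Xc [|i]; rewrite coefC.
have [||||p [p0 pA px]] := @acl_frac _ A _ _ _ _ _ _ xy.
- by exists 1%:P; [apply: gC; exact: gen1 | rewrite hornerC].
- move=> _ _ [a Xa <-] [b Xb <-].
  exists (a - b); last by rewrite hornerD hornerN.
  by move=> i; rewrite coefB; apply: genB.
- move=> _ _ [a Xa <-] [b Xb <-]; exists (a * b); last by rewrite hornerM.
  by move=> i; rewrite coefM; apply/gen_predP/rpred_sum => j _;
     apply: rpredM; apply/gen_predP.
- move=> z [Xz|]; first by exists z%:P; [apply/gC/gen_in | rewrite hornerC].
  rewrite inE => /eqP ->; exists 'X; last by rewrite hornerX.
  by move=> i; rewrite coefX; case: eqP => _; [exact: gen1 | exact: g0].
have [d dP] : exists d : nat -> {poly F},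
    forall i, (forall j, gen X (d i)`_j) /\ (d i).[y] = p`_i.
  exists (fun i => projT1 (cid2 (pA i))) => i.
  by case: (cid2 (pA i)).
(* p(x, U), where p(T, U) is the sum of the T^i * d i *)
pose r := \sum_(i < size p) x ^+ i *: d i.
have ry : root r y.
  apply/rootP; apply: etrans (rootP px).
  rewrite horner_sum horner_coef; apply: eq_bigr => i _.
  by rewrite hornerZ (dP i).2 mulrC.
have [r0|r0] := eqVneq r 0; last first.
  exists r; split=> // i; rewrite coef_sum.
  have sub z : gen X z -> z \in gen_pred (ext X [:: x]).
    move=> Xz; apply/gen_predP; apply: gen_mono Xz => w Xw.
    by apply: gen_in; left.
  apply/gen_predP/rpred_sum => j _; rewrite coefZ; apply: rpredM.
    by apply/rpredX/gen_predP/gen_in; right; rewrite inE.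
  exact: sub ((dP j).1 i).
have d0 i : (i < size p)%N -> d i = 0.
  move=> ip; apply/polyP => k; rewrite coef0.
  (* the coefficient of U^k in p(T, U) *)
  pose e := \poly_(j < size p) (d j)`_k.
  have eX j : gen X e`_j.
    by rewrite coef_poly; case: ifP => // _; apply: (dP j).1.
  have ex : root e x.
    apply/rootP; move/(congr1 (fun q : {poly F} => q`_k)): r0.
    rewrite coef0 coef_sum => r0k.
    rewrite horner_poly; apply: etrans r0k.
    by apply: eq_bigr => j _; rewrite coefZ mulrC.
  have [e0|e0] := eqVneq e 0; last by case: xX; exists e.
  by have := congr1 (fun q : {poly F} => q`_i) e0; rewrite coef_poly ip coef0.
case/eqP: p0; apply/polyP => i; rewrite coef0.
have [/d0 di|pi] := ltnP i (size p); last by rewrite nth_default.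
by rewrite -(dP i).2 di horner0.
Qed.

(** Independence of each entry from the preceding ones only: in this form it is
    inherited by the tail of the list when the head is moved into X. *)
Definition aindep X t : Prop :=
  forall i, (i < size t)%N -> ~ acl (ext X (take i t)) t`_i.

(** The head y of the independent list is moved into the base. As y is algebraic
    over s but not over the empty list, some z in s is the first whose addition
    to the preceding elements makes y algebraic; by exchange z is then
    algebraic over y and these elements, so that z can be dropped from s. *)
Theorem steinitz X s t :
  (forall x, acl (ext X s) x) -> aindep X t -> (size t <= size s)%N.
Proof.
elim: t X s => [//|y t IH] X s Xs yt.
have yX : ~ acl (ext X [::]) y by apply: (yt 0%N).
have [s1 [z [s2 [def_s y1 y2]]]] : exists s1 z s2,
    [/\ s = s1 ++ z :: s2, ~ acl (ext X s1) y & acl (ext X (rcons s1 z)) y].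
  have := Xs y; elim/last_ind: s {Xs} => [//|s z IHs] yz.
  have [ys|ys] := pselect (acl (ext X s) y); last first.
    by exists s, z, [::]; rewrite cats1.
  have [s1 [w [s2 [-> h1 h2]]]] := IHs ys.
  by exists s1, w, (rcons s2 z); rewrite rcons_cat.
have zy : acl (ext (ext X s1) [:: y]) z.
  apply: acl_exchange y1; apply: acl_mono y2 => x [Xx|]; first by left; left.
  rewrite mem_rcons inE => /predU1P[->|xs]; last by left; right.
  by right; rewrite inE.
have -> : size s = (size (s1 ++ s2)).+1 by rewrite def_s !size_cat addnS.
apply: (IH (ext X [:: y])) => [x|i it].
  apply: acl_trans (Xs x) => w [Xw|]; first by apply: acl_in; left; left.
  rewrite def_s mem_cat inE => /or3P[ws|/eqP ->|ws].
  - by apply: acl_in; right; rewrite mem_cat ws.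
  - apply: acl_mono zy => u [[Xu|us]|uy]; [by left; left | | by left; right].
    by right; rewrite mem_cat us.
  - by apply: acl_in; right; rewrite mem_cat ws orbT.
move=> ti; apply: (yt i.+1 it); apply: acl_mono ti => u /=.
case=> [[Xu|]|ut]; [by left | rewrite inE => /eqP -> | ]; right.
  exact: mem_head.
by rewrite inE ut orbT.
Qed.
End Steinitz.

(** * Algebraic independence and algebraic closure *)

Section AlgIndep.
Variables (K F : fieldType) (iota : {rmorphism K -> F}).

Definition in_image : F -> Prop := fun x => exists c, x = iota c.

(** An equation for t k over the other t j lifts to a polynomial relation Q.
    That Q is nonzero is seen through the evaluation ev, which sends the k-th
    variable to 'X and the others to the constants t j: ev Q is the equation. *)
Lemma alg_indep_acl m (t : 'I_m -> F) k : alg_indep iota t ->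
  ~ acl (fun x => in_image x \/ exists2 j, j != k & x = t j) (t k).
Proof.
move=> ind tk.
pose ev : {rmorphism mpoly.mpoly m K -> {poly F}} :=
  mpoly.mmap (polyC \o iota : {rmorphism K -> {poly F}})
    (fun j => if j == k then 'X else (t j)%:P).
pose A c := exists P, ev P = c%:P.
have evC c : ev (mpoly.mpolyC m c) = (iota c)%:P by apply: mpoly.mmapC.
have evX j : ev (mpoly.mpolyX K (mpoly.mnm1 j)) =
    if j == k then 'X else (t j)%:P.
  by rewrite /ev /= mpoly.mmapX mpoly.mmap1U.
have [||||p [p0 pA px]] := @acl_frac _ A _ _ _ _ _ _ tk.
- by exists (mpoly.mpolyC m 1); rewrite evC rmorph1.
- by move=> x y [P Px] [Q Qy]; exists (P - Q); rewrite rmorphB Px Qy polyCB.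
- by move=> x y [P Px] [Q Qy]; exists (P * Q); rewrite rmorphM Px Qy polyCM.
- move=> x [[c ->]|[j jk ->]]; first by exists (mpoly.mpolyC m c).
  by exists (mpoly.mpolyX K (mpoly.mnm1 j)); rewrite evX (negbTE jk).
pose d i := projT1 (cid (pA i)).
have dP i : ev (d i) = (p`_i)%:P by rewrite /d; case: (cid (pA i)).
pose Q := \sum_(i < size p) d i * mpoly.mpolyX K (mpoly.mnm1 k) ^+ i.
have evQ : ev Q = p.
  rewrite rmorph_sum -[RHS]coefK poly_def; apply: eq_bigr => i _.
  by rewrite rmorphM rmorphXn /= dP evX eqxx mul_polyC.
have evt P : mpoly.mmap iota t P = (ev P).[t k].
  rewrite /ev /mpoly.mmap horner_sum; apply: eq_bigr => w _.
  rewrite hornerM hornerC; congr (_ * _).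
  rewrite /mpoly.mmap1 horner_prod; apply: eq_bigr => i _.
  by rewrite horner_exp; case: eqP => [->|_]; rewrite ?hornerX ?hornerC.
case/eqP: p0; rewrite -evQ (ind Q) ?rmorph0 //.
by rewrite evt evQ; apply/rootP.
Qed.

Lemma alg_indep_leq m (t : 'I_m -> F) s : alg_indep iota t ->
  (forall x, acl (ext in_image s) x) -> (m <= size s)%N.
Proof.
move=> ind sp; rewrite -[m]size_enum_ord -(size_map t).
apply: steinitz sp _ => i; rewrite size_map size_enum_ord => im.
rewrite (nth_map (Ordinal im)) ?size_enum_ord // -map_take => ti.
apply: (alg_indep_acl (k := nth (Ordinal im) (enum 'I_m) i) ind).
apply: acl_mono ti => x [[c ->]|]; first by left; exists c.
case/mapP => j jt ->; right; exists j => //.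
apply: contraTneq jt => ->.
rewrite -[X in _ \notin take X _]
  (index_uniq (Ordinal im) _ (enum_uniq 'I_m)) ?size_enum_ord //.
by rewrite in_take ?ltnn // mem_nth ?size_enum_ord.
Qed.
End AlgIndep.

(** * Differential polynomials with variables in a given set *)

Section Variables.
Variables (K : fieldType) (n : nat).
Local Notation R := {dpoly K[n]}.
Implicit Types (f g : R) (v w : dvar n) (m : {cmonom (dvar n)}).
Implicit Types (V : dvar n -> Prop).

Definition vars_in V f : Prop := forall v, v \in dvars f -> V v.

Lemma divcm_ucm v m m' : (0 < m v)%N ->
  (divcm m (ucm v) == m') = (m == mmul m' (ucm v)).
Proof.
move=> mv; apply/cmP/cmP => h w.
  rewrite cmM -h divcmE ucmE; case: (v =P w) => [<-|_]; first by rewrite subnK.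
  by rewrite subn0 addn0.
by rewrite divcmE h cmM addnK.
Qed.

Lemma pderiv_sum v (I : Type) (s : seq I) (G : I -> R) :
  pderiv v (\sum_(i <- s) G i) = \sum_(i <- s) pderiv v (G i).
Proof.
apply: (big_morph _ (pderivD v)).
by apply: (addrI (pderiv v 0)); rewrite -pderivD !addr0.
Qed.

Lemma mcoeff_sum m (I : Type) (s : seq I) (G : I -> R) :
  (\sum_(i <- s) G i)@_m = \sum_(i <- s) (G i)@_m.
Proof. exact: raddf_sum. Qed.

Lemma mcoeff_pderiv v f m :
  (pderiv v f)@_m = f@_(mmul m (ucm v)) *+ (m v).+1.
Proof.
rewrite [f]monalgE pderiv_sum !mcoeff_sum -sumrMnl.
apply: eq_bigr => p _; rewrite pderivU !mcoeffU.
have [p0|p0] := posnP (p v).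
  rewrite p0 mulr0n mul0rn; case: eqP => [pm|_]; last by rewrite mul0rn.
  by move: p0; rewrite pm cmM cmU eqxx addn1.
rewrite (divcm_ucm _ p0); case: eqP => [->|_]; last by rewrite mul0rn.
by rewrite !mulr1n cmM cmU eqxx addn1.
Qed.

Lemma vars_inP V f :
  vars_in V f <-> forall m, m \in msupp f -> forall v, (0 < m v)%N -> V v.
Proof.
split=> h.
  move=> m mf v mv; apply: h; apply/dvarsP.
  by exists m; rewrite // -cmE_neq0 -lt0n.
by move=> v /dvarsP [m mf vm]; apply: h mf _ _; rewrite lt0n cmE_neq0.
Qed.

Lemma vars_inW V V' f : (forall v, V v -> V' v) -> vars_in V f -> vars_in V' f.
Proof. by move=> VV h v /h /VV. Qed.

Lemma vars_in0 V : vars_in V 0.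
Proof. by apply/vars_inP => m; rewrite msupp0. Qed.

Lemma vars_inD V f g : vars_in V f -> vars_in V g -> vars_in V (f + g).
Proof.
move=> /vars_inP hf /vars_inP hg; apply/vars_inP => m.
by move/(fsubsetP (msuppD_le f g)); rewrite in_fsetU => /orP[/hf|/hg].
Qed.

Lemma vars_in_sum V (I : eqType) (s : seq I) (G : I -> R) :
  (forall i, i \in s -> vars_in V (G i)) -> vars_in V (\sum_(i <- s) G i).
Proof.
move=> h; rewrite big_seq; elim/big_ind: _ => //; first exact: vars_in0.
by move=> f g; apply: vars_inD.
Qed.

Lemma vars_inM V f g : vars_in V f -> vars_in V g -> vars_in V (f * g).
Proof.
move=> /vars_inP hf /vars_inP hg; apply/vars_inP => m /msuppM_le [m1 [m2]].
case=> [m1f m2g def_m] v; rewrite def_m cmM addn_gt0.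
by case/orP; [exact: hf | exact: hg].
Qed.

Lemma vars_inU V c m : (forall v, (0 < m v)%N -> V v) -> vars_in V << c *g m >>.
Proof.
move=> h; apply/vars_inP => m' /(fsubsetP msuppU_le).
by rewrite in_fset1 => /eqP ->.
Qed.

Lemma vars_in_dX V v : V v -> vars_in V (dX K v).
Proof.
move=> Vv; apply: vars_inU => w; rewrite cmU.
by case: eqP => [<-|].
Qed.

Lemma vars_in_pderiv V v f : vars_in V f -> vars_in V (pderiv v f).
Proof.
move=> /vars_inP h; apply/vars_inP => m.
rewrite -mcoeff_neq0 mcoeff_pderiv => mf w mw.
apply: (h (mmul m (ucm v))); last by rewrite cmM addn_gt0 mw.
by rewrite -mcoeff_neq0; apply: contraNneq mf => ->; rewrite mul0rn.
Qed.

Lemma vars_in_coefder V delta f : vars_in V f -> vars_in V (coefder delta f).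
Proof.
move=> /vars_inP h; apply: vars_in_sum => m mf.
by apply: vars_inU => v; apply: h.
Qed.

(** Constants and variables generate the ring of polynomials; since a polynomial
    only needs the variables that occur in it, the induction can be restricted
    to these. *)
Lemma dpoly_ind V (Q : R -> Prop) :
  (forall c, Q (dconst c)) -> (forall v, V v -> Q (dX K v)) ->
  (forall f g, Q f -> Q g -> Q (f + g)) ->
  (forall f g, Q f -> Q g -> Q (f * g)) ->
  forall f, vars_in V f -> Q f.
Proof.
move=> QC QX QD QM f /vars_inP hf; rewrite [f]monalgE big_seq.
elim/big_ind: _ => [|//|m mf]; first by rewrite -(malgC0E : dconst 0 = 0).
move: {f hf mf} (f@_m) (hf m mf) => c.
have [d] := ubnP (mdeg m); elim: d m => // d IH m /ltnSE md mV.
have [->|m1] := eqVneq m mone; first exact: QC.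
have [v vm] : exists v, (0 < m v)%N.
  apply/not_existsP => m0; case/eqP: m1; apply/eqP/cmP => v; rewrite cm1.
  by apply/eqP; rewrite -leqn0 leqNgt; apply/negP/m0.
have def_m : m = mmul (ucm v) (divcm m (ucm v)).
  by rewrite mulmC; apply/eqP; rewrite -(divcm_ucm _ vm).
have -> : << c *g m >> = dX K v * << c *g divcm m (ucm v) >> :> R.
  by rewrite [in LHS]def_m -[c in LHS]mul1r; apply/esym/monalgM.
apply: QM; first exact/QX/mV.
apply: IH => [|w]; last first.
  by rewrite divcmE => /leq_trans/(_ (leq_subr _ _)); apply: mV.
by apply: leq_trans _ md; rewrite [in leqRHS]def_m mdegM mdegU.
Qed.
End Variables.

(** * Rankings are well-orders *)

Section RankingTheory.
Variables (n : nat) (lt : rel (dvar n)).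
Hypothesis ltP : ranking lt.
Implicit Types (v w : dvar n).

Lemma vder0 v : vder 0 v = v.
Proof. by case: v => i r; rewrite /vder addn0. Qed.

Lemma vderS k v : vder k.+1 v = vder 1 (vder k v).
Proof. by rewrite /vder /= addn1 addnS. Qed.

Lemma lt_vder k v : (0 < k)%N -> lt v (vder k v).
Proof.
case: k => // k _; elim: k => [|k IH]; first exact: (ranking_lt_vder ltP).
by rewrite vderS; apply: (ranking_trans ltP IH); exact: (ranking_lt_vder ltP).
Qed.

Lemma lt_asym v w : lt v w -> ~~ lt w v.
Proof.
move=> vw; apply/negP => /(ranking_trans ltP vw).
by rewrite (ranking_irr ltP).
Qed.

Lemma vder_fst v w : v.1 = w.1 -> (v.2 <= w.2)%N -> w = vder (w.2 - v.2) v.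
Proof. by case: v w => [i r] [j s] /= -> rs; rewrite /vder /= subnKC. Qed.

Lemma least_var (s : seq (dvar n)) v : v \in s ->
  exists2 u, u \in s & forall w, w \in s -> ~~ lt w u.
Proof.
elim: s v => [//|v [|v' s] IH] _ _.
  by exists v => [|w]; rewrite inE // => /eqP ->; rewrite (ranking_irr ltP).
have [u us umin] := IH v' (mem_head _ _).
have [vu|vu] := boolP (lt v u).
  exists v => [|w]; rewrite inE ?eqxx // => /predU1P[->|/umin].
    by rewrite (ranking_irr ltP).
  by apply: contra => /(ranking_trans ltP); apply.
by exists u => [|w]; rewrite inE ?us ?orbT // => /predU1P[->|/umin].
Qed.

(** Each row {x_i^(r)} is ordered by r, so a nonempty set of variables has a
    least element in each of the finitely many rows that it meets, and the
    least of these is its minimum. *)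
Lemma ranking_ind (Q : dvar n -> Prop) :
  (forall v, (forall w, lt w v -> Q w) -> Q v) -> forall v, Q v.
Proof.
move=> QI v0; apply: contrapT => Qv0.
have /choice [q qP] : forall i, exists q, forall r, ~ Q (i, r) ->
    ~ Q (i, q) /\ (q <= r)%N.
  move=> i; have [ex|nex] := pselect (exists r, `[< ~ Q (i, r) >]); last first.
    by exists 0%N => r Qr; case: nex; exists r; apply/asboolP.
  case: (ex_minnP ex) => q /asboolP Qq qmin.
  by exists q => r /asboolP /qmin.
pose s := [seq (i, q i) | i <- enum 'I_n & `[< ~ Q (i, q i) >]].
have sP i : ~ Q (i, q i) -> (i, q i) \in s.
  by move=> Qi; apply: map_f; rewrite mem_filter mem_enum andbT; apply/asboolP.
have [u us umin] : exists2 u, u \in s & forall w, w \in s -> ~~ lt w u.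
  case: v0 Qv0 => i r /qP [Qi _]; exact: least_var (sP _ Qi).
have Qu : ~ Q u.
  by case/mapP: us => i; rewrite mem_filter => /andP[/asboolP Qi _] ->.
apply/Qu/QI => -[i r] wu; apply: contrapT => /qP [Qi].
have qu := umin _ (sP _ Qi).
rewrite leq_eqVlt => /predU1P[qr|qr]; first by rewrite qr wu in qu.
have qw : lt (i, q i) (i, r).
  rewrite (@vder_fst (i, q i) (i, r)) 1?ltnW //.
  by apply: lt_vder; rewrite subn_gt0.
by rewrite (ranking_trans ltP qw wu) in qu.
Qed.
End RankingTheory.

(** * Derivatives, degrees and leaders *)

Section Leaders.
Variables (K : fieldType) (delta : K -> K) (n : nat) (lt : rel (dvar n)).
Hypotheses (deltaP : derivation delta) (ltP : ranking lt).
Local Notation R := {dpoly K[n]}.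
Implicit Types (f g : R) (v w l : dvar n).

Definition below w f : Prop := vars_in (fun v => lt v w) f.

(** The derivation turns v < w into the next variable of its row, which is below
    the derivative of w; all other factors keep variables below w, and w is
    itself below its derivative. *)
Lemma dder_below w f : below w f -> below (vder 1 w) (dder delta f).
Proof.
move=> fw; have fw' : below (vder 1 w) f.
  by apply: vars_inW fw => v vw; apply: (ranking_trans ltP vw); exact: lt_vder.
apply: vars_inD; first exact: vars_in_coefder.
apply: vars_in_sum => v vf; apply: vars_inM; first exact: vars_in_pderiv.
by apply: vars_in_dX; apply: (ranking_vder ltP); apply: fw.
Qed.

(** In the chain rule, each variable v of f contributes the derivative of v,
    which is below that of l unless v = l. *)
Lemma dder_leader f l : leader lt f = Some l ->
  exists2 T, below (vder 1 l) T &
    dder delta f = pderiv l f * dX K (vder 1 l) + T.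
Proof.
move=> /(leaderP ltP) [lf lmax].
have fl : below (vder 1 l) f.
  move=> v /lmax [->|vl]; first exact: lt_vder.
  by apply: (ranking_trans ltP vl); exact: lt_vder.
exists (coefder delta f +
    \sum_(v <- dvars f | v != l) pderiv v f * dX K (vder 1 v)).
  apply: vars_inD; first exact: vars_in_coefder.
  rewrite -big_filter; apply: vars_in_sum => v; rewrite mem_filter.
  case/andP=> vl vf; apply: vars_inM; first exact: vars_in_pderiv.
  apply: vars_in_dX; apply: (ranking_vder ltP).
  by case: (lmax v vf) vl => [->|//]; rewrite eqxx.
by rewrite /dder (bigD1_seq l) ?fset_uniq //= addrCA.
Qed.

(** Each further derivation only moves the separant to the next derivative of l:
    the derivative of the separant multiplies the old one, which is smaller. *)
Lemma iter_dder_leader f l k : leader lt f = Some l ->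
  exists2 T, below (vder k.+1 l) T &
    iter k.+1 (dder delta) f = pderiv l f * dX K (vder k.+1 l) + T.
Proof.
move=> fl; have [lf lmax] := (leaderP ltP f l).1 fl.
elim: k => [|k [T Tl IH]]; first exact: dder_leader.
rewrite iterS IH (dder_derivation n deltaP).1 (dder_derivation n deltaP).2.
rewrite dder_dX // -vderS addrAC addrC.
exists (dder delta (pderiv l f) * dX K (vder k.+1 l) + dder delta T) => //.
have ll : lt (vder k.+1 l) (vder k.+2 l).
  by rewrite (vderS k.+1); exact: lt_vder.
rewrite (vderS k.+1); apply: vars_inD; last exact: dder_below Tl.
apply: vars_inM; last by apply: vars_in_dX; rewrite -vderS.
apply: dder_below; apply: vars_in_pderiv => v /lmax [->|vl].
  exact: lt_vder.
by apply: (ranking_trans ltP vl); exact: lt_vder.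
Qed.

Lemma leq_degv v f m : m \in msupp f -> (m v <= degv v f)%N.
Proof.
move=> mf; rewrite /degv.
have := @leq_bigmax_seq _ _ xpredT (fun m : {cmonom (dvar n)} => m v) _ mf.
exact.
Qed.

Lemma degv_gt0 v f : v \in dvars f -> (0 < degv v f)%N.
Proof.
case/dvarsP => m mf vm; apply: leq_trans (leq_degv v mf).
by rewrite lt0n cmE_neq0.
Qed.

Lemma degv_eq0 v f : v \notin dvars f -> degv v f = 0%N.
Proof.
move=> vf; apply/eqP; rewrite -leqn0; apply/bigmax_leqP_seq => m mf _.
by rewrite leqn0 cmE_eq0; apply: contra vf => vm; apply/dvarsP; exists m.
Qed.

Lemma msupp_pderiv v f m :
  m \in msupp (pderiv v f) -> mmul m (ucm v) \in msupp f.
Proof.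
rewrite -!mcoeff_neq0 mcoeff_pderiv.
by apply: contraNneq => ->; rewrite mul0rn.
Qed.

Lemma degv_pderiv_le v w f : (degv v (pderiv w f) <= degv v f)%N.
Proof.
apply/bigmax_leqP_seq => m /msupp_pderiv mf _.
by apply: leq_trans (leq_degv v mf); rewrite cmM leq_addr.
Qed.

Lemma degv_pderiv_lt v f : v \in dvars f -> (degv v (pderiv v f) < degv v f)%N.
Proof.
move=> vf; rewrite -(prednK (degv_gt0 vf)) ltnS.
apply/bigmax_leqP_seq => m /msupp_pderiv mf _.
rewrite -ltnS (prednK (degv_gt0 vf)).
by apply: leq_trans (leq_degv v mf); rewrite cmM cmU eqxx addn1.
Qed.

(** No monomial containing v cancels: distinct monomials keep distinct
    quotients by v, and the exponent of v is invertible. *)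
Lemma pderiv_neq0 v f : [pchar K] =i pred0 -> v \in dvars f -> pderiv v f != 0.
Proof.
move=> K0 /dvarsP [m mf vm].
have mv : (0 < m v)%N by rewrite lt0n cmE_neq0.
apply/eqP => /(congr1 (mcoeff (divcm m (ucm v)))); apply/eqP.
have def_m : m == mmul (divcm m (ucm v)) (ucm v) by rewrite -divcm_ucm.
rewrite mcoeff_pderiv -(eqP def_m) mcoeff0 -mulr_natr mulf_eq0 negb_or.
rewrite mcoeff_neq0 mf /= ((pcharf0P K).1 K0).
by [].
Qed.
End Leaders.

(** * Algebraicity of residues *)

Section ResidueMorphism.
Local Open Scope quotient_scope.

Lemma fraction_ratio (Q : idomainType) (x : {fraction Q}) :
  exists a b : Q, x = FracField.tofrac a / FracField.tofrac b.
Proof.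
elim/quotW: x => r; exists (frac r).1, (frac r).2.
rewrite -[r in LHS]Ratio_numden; unlock FracField.tofrac.
rewrite -[X in _ = _ * X]FracField.pi_inv -[RHS]FracField.pi_mul.
rewrite /FracField.mulf /FracField.invf /= !numden_Ratio
  ?(oner_neq0, mul1r, mulr1, denom_ratioP) //.
Qed.
Variables (R : comNzRingType) (P : prime_idealr R).

(** These instances of the morphism laws over an abstract ring spare unification
    from unfolding the multiplication of differential polynomials. *)
Lemma residueD : {morph residue_frac P : f g / f + g}.
Proof. exact: rmorphD. Qed.

Lemma residueM : {morph residue_frac P : f g / f * g}.
Proof. exact: rmorphM. Qed.

Lemma residue0 : residue_frac P 0 = 0.
Proof. exact: rmorph0. Qed.

Lemma residue1 : residue_frac P 1 = 1.
Proof. exact: rmorph1. Qed.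

Lemma residue_eq0 f : residue_frac P f = 0 <-> f \in P.
Proof. by rewrite -residue_frac_eq0; split=> /eqP. Qed.

Lemma residue_fracP (x : {fraction {ideal_quot P}}) :
  exists f g, x = residue_frac P f / residue_frac P g.
Proof.
have [a [b ->]] := fraction_ratio x.
by exists (repr a), (repr b); rewrite /residue_frac !reprK.
Qed.
End ResidueMorphism.

Section Residues.
Variables (K : fieldType) (n : nat) (P : prime_idealr {dpoly K[n]}).
Local Notation R := {dpoly K[n]}.
Local Notation F := {fraction {ideal_quot P}}.
Local Notation res := (residue_frac P).
Implicit Types (f g : R) (v w l : dvar n) (X : F -> Prop).

Lemma dconst_mem_prime c : dconst c \in P -> c = 0.
Proof.
move/residue_eq0/eqP; rewrite -[_ (dconst c)]/((res \o dconst) c).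
by rewrite fmorph_eq0 => /eqP.
Qed.

Section Algebraic.
Variable X : F -> Prop.
Hypothesis XK : forall c, acl X (res (dconst c)).

Lemma acl_residue f :
  vars_in (fun v => acl X (res (dX K v))) f -> acl X (res f).
Proof.
apply: (@dpoly_ind K n _ (fun f => acl X (res f)))
  => [c|v vX|g h Xg Xh|g h Xg Xh].
- exact: XK.
- exact: vX.
- by rewrite residueD; apply: aclD.
- by rewrite residueM; apply: aclM.
Qed.

(** Read f as a polynomial p in l: then p vanishes at the residue of l, and p is
    nonzero because its derivative takes there the value of the separant, which
    is nonzero modulo P. The polynomial p and the values of p and of its
    derivative are built up together by induction on f. *)
Lemma acl_leader f l : f \in P -> pderiv l f \notin P ->
  vars_in (fun v => v = l \/ acl X (res (dX K v))) f -> acl X (res (dX K l)).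
Proof.
move=> fP dfP /(@dpoly_ind K n _ (fun f => exists p : {poly F},
  [/\ forall i, acl X p`_i, p.[res (dX K l)] = res f
    & p^`().[res (dX K l)] = res (pderiv l f)])).
case=> [c|v vl|g h [p [pX pg pg']] [q [qX qh qh']]
  |g h [p [pX pg pg']] [q [qX qh qh']]|p [pX pf pf']].
- exists (res (dconst c))%:P; rewrite hornerC derivC horner0; split=> [i||].
  - by rewrite coefC; case: eqP => _; [exact: XK | exact: acl0].
  - by [].
  - have -> : pderiv l (dconst c) = 0 :> R.
      by rewrite pderivU cm1 mulr0n monalgU0.
    exact/esym/residue0.
- have [->|vl'] := eqVneq v l.
    have -> : pderiv l (dX K l) = 1 by rewrite pderiv_dX eqxx.
    exists 'X; rewrite hornerX derivX hornerC; split=> [i||].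
    - by rewrite coefX; case: eqP => _; [exact: acl1 | exact: acl0].
    - by [].
    - exact/esym/residue1.
  have -> : pderiv l (dX K v) = 0 by rewrite pderiv_dX (negbTE vl').
  exists (res (dX K v))%:P; rewrite hornerC derivC horner0; split=> [i||].
  - rewrite coefC; case: eqP => // _; last exact: acl0.
    by case: vl vl' => // ->; rewrite eqxx.
  - by [].
  - exact/esym/residue0.
- exists (p + q); split=> [i||].
  - by rewrite coefD; apply: aclD.
  - by rewrite hornerD pg qh residueD.
  - by rewrite derivD hornerD pg' qh' pderivD residueD.
- exists (p * q); split=> [i||].
  - rewrite coefM.
    by elim/big_ind: _ => [|x y|j _]; [exact: acl0 | exact: aclD | exact: aclM].
  - by rewrite hornerM pg qh residueM.
  - rewrite derivM hornerD !hornerM pg qh pg' qh' pderivM residueD.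
    by apply: congr2; apply/esym/residueM.
apply: (@acl_root _ _ p) => //; last first.
  by apply/rootP; rewrite pf; apply/residue_eq0.
apply: contraNneq dfP => p0; apply/residue_eq0.
by rewrite -pf' p0 deriv0 horner0.
Qed.
End Algebraic.
End Residues.

(** * Reduced elements of the ideal *)

Section Reduction.
Variables (K : fieldType) (n : nat) (lt : rel (dvar n)).
Variables (P : prime_idealr {dpoly K[n]}) (A : seq {dpoly K[n]}).
Hypotheses (ltP : ranking lt) (AP : characteristic_set lt P A).
Local Notation R := {dpoly K[n]}.
Implicit Types (f g : R).

(** If f is nonzero, then the A_i with leader below that of f, followed by f,
    form an autoreduced sequence in P. At its position f either has lower rank
    than the entry of A, as f is reduced with respect to it, or extends A; both
    contradict minimality. *)
Lemma reduced_mem_eq0 f :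
  f \in P -> (forall g, g \in A -> reduced lt f g) -> f = 0.
Proof.
case: AP => -[Anc Asort Ared] AsubP Amin fP fred.
case: (pselect (exists c, f = dconst c)) => [[c fc]|fnc].
  by move: fP; rewrite fc => /dconst_mem_prime ->; exact: malgC0E.
case fl: (leader lt f) => [l|]; last by case: fnc; apply/(leader_None ltP).
have [lf lmax] := (leaderP ltP f l).1 fl.
(* the number of A_i with a leader below that of f, as the leaders increase *)
pose k := find (fun g => ~~ leader_lt lt g f) A.
have kA : (k <= size A)%N by exact: find_size.
have szk : size (take k A) = k by rewrite size_takel.
have below_k i : (i < k)%N -> leader_lt lt A`_i f.
  by move=> ik; have := before_find 0 ik; move/negbFE.
pose B := rcons (take k A) f.
have szB : size B = k.+1 by rewrite size_rcons szk.
have nthB i : (i < k)%N -> B`_i = A`_i.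
  by move=> ik; rewrite nth_rcons szk ik nth_take.
have nthBk : B`_k = f by rewrite nth_rcons szk ltnn eqxx.
have Bred : autoreduced lt B.
  split.
  - by move=> g; rewrite mem_rcons inE => /predU1P[->//|/mem_take]; exact: Anc.
  - rewrite pairwise_rcons (subseq_pairwise (take_subseq _ _) Asort) andbT.
    by apply/(all_nthP 0) => i; rewrite szk => ik; rewrite nth_take // below_k.
  move=> i j; rewrite szB !ltnS => ik jk ij.
  have [jlt|jge] := ltnP j k; last first.
    have jE : j = k by apply/eqP; rewrite eqn_leq jk.
    have {}ik : (i < k)%N by rewrite ltn_neqAle ik -jE ij.
    rewrite jE nthBk nthB // /reduced fl.
    have := below_k i ik; rewrite /leader_lt fl.
    case al: (leader lt A`_i) => [a|//] lal.
    have [aA amax] := (leaderP ltP _ _).1 al.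
    have lA v : v \in dvars A`_i -> lt v l.
      by move=> /amax [->//|va]; apply: (ranking_trans ltP va).
    split=> [h h0|].
      apply/negP => /lA ll; have := lt_asym ltP (lt_vder ltP l h0).
      by rewrite ll.
    rewrite degv_eq0 ?degv_gt0 //; apply/negP => /lA.
    by rewrite (ranking_irr ltP).
  have [ilt|ige] := ltnP i k.
    by rewrite !nthB //; apply: Ared => //; apply: leq_trans kA.
  have -> : i = k by apply/eqP; rewrite eqn_leq ik.
  by rewrite nthBk (nthB j) //; apply/fred/mem_nth/(leq_trans jlt).
have BP : {subset B <= P}.
  by move=> g; rewrite mem_rcons inE => /predU1P[->//|/mem_take]; exact: AsubP.
case: (Amin B Bred BP).
have [kA'|kA'] := ltnP k (size A); last first.
  right; rewrite szB ltnS; split=> // j jA.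
  by rewrite nthB //; apply: leq_trans kA'.
left; exists k; rewrite szB leq_min ltnSn kA'; split=> // [j jk|].
  by rewrite nthB.
rewrite nthBk /rank_lt /rank fl.
have := nth_find 0 (_ : has (fun g => ~~ leader_lt lt g f) A).
rewrite has_find -/k kA' => /(_ isT).
rewrite /leader_lt fl; have := fred _ (mem_nth 0 kA'); rewrite /reduced.
case: (leader lt A`_k) => [a|//] [adv adeg] /= al.
case: (eqVneq l a) => [->|la]; first by rewrite adeg orbT.
by have := ranking_total ltP la; rewrite (negbTE al) => ->.
Qed.

Section Separants.
Hypothesis K0 : [pchar K] =i pred0.

(** Differentiation lowers the degree in l and adds no variable, so the separant
    is reduced with respect to every element of A; in characteristic zero it is
    nonzero, which excludes it from P. *)
Lemma leader_separant i l : (i < size A)%N -> leader lt A`_i = Some l ->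
  pderiv l A`_i \notin P.
Proof.
move=> iA al; have [lA lmax] := (leaderP ltP _ _).1 al.
have := pderiv_neq0 K0 lA; apply: contra => sP; apply/eqP.
apply: reduced_mem_eq0 => // g /(nthP 0) [j jA <-].
case: AP => -[Anc _ Ared] _ _.
have sub v : v \in dvars (pderiv l A`_i) -> v \in dvars A`_i.
  exact: (@vars_in_pderiv _ _ (fun v => v \in dvars A`_i)).
have [ij|ij] := eqVneq i j.
  rewrite -ij /reduced al; split; last exact: degv_pderiv_lt.
  move=> k k0; apply/negP => /sub /lmax [/esym|] ll.
    by have := lt_vder ltP l k0; rewrite -ll (ranking_irr ltP).
  by have := lt_asym ltP (lt_vder ltP l k0); rewrite ll.
have := Ared i j iA jA ij; rewrite /reduced.
case: (leader lt A`_j) => [a|//] [ak adeg]; split.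
  by move=> k /ak; apply: contra => /sub.
exact: leq_ltn_trans (degv_pderiv_le _ _ _) adeg.
Qed.
End Separants.
End Reduction.

(** * The staircase of leaders *)

Section Staircase.
Variables (K : fieldType) (n : nat) (lt : rel (dvar n)).
Variables (A : 'I_n -> {dpoly K[n]}) (L : 'I_n -> dvar n).
Hypotheses (ltP : ranking lt) (LP : forall i, leader lt (A i) = Some (L i)).
Hypothesis Ared : forall i j, i != j -> reduced lt (A i) (A j).

(** A variable in the row of L j of larger order is a proper derivative of L j.
    It cannot occur in A i, by reducedness if i <> j, and because it is larger
    than the leader if i = j. *)
Lemma dvars_order_le i j v : v \in dvars (A i) -> v.1 = (L j).1 ->
  (v.2 <= (L j).2)%N.
Proof.
move=> vA vj; rewrite leqNgt; apply/negP => jv.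
have def_v := vder_fst (esym vj) (ltnW jv).
have k0 : (0 < v.2 - (L j).2)%N by rewrite subn_gt0.
have [ij|ij] := eqVneq i j; last first.
  have := Ared ij; rewrite /reduced LP => -[/(_ _ k0)].
  by rewrite -def_v vA.
have [_ /(_ v)] := (leaderP ltP _ _).1 (LP i).
rewrite ij in vA *; have := lt_vder ltP (L j) k0; rewrite -def_v => Lv.
case=> // [vL|vL]; first by rewrite vL (ranking_irr ltP) in Lv.
by have := lt_asym ltP Lv; rewrite vL.
Qed.

Lemma leader_in i : L i \in dvars (A i).
Proof. by have [] := (leaderP ltP _ _).1 (LP i). Qed.

(** Two leaders in the same row bound the order of each other, so they coincide;
    then the degrees in the common leader would decrease both ways. *)
Lemma leader_row_inj : injective (fun i => (L i).1).
Proof.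
move=> i j ij; apply/eqP; apply: contraT => nij.
have eqL : L i = L j.
  rewrite [L i]surjective_pairing [L j]surjective_pairing ij; congr (_, _).
  apply/eqP; rewrite eqn_leq (dvars_order_le (leader_in i) ij).
  by rewrite (dvars_order_le (leader_in j) (esym ij)).
have := Ared nij; rewrite /reduced LP => -[_ h1].
rewrite eq_sym in nij; have := Ared nij; rewrite /reduced LP => -[_].
by rewrite eqL => /(ltn_trans h1); rewrite ltnn.
Qed.

(** The bound on each row holds for every permutation; the matching t^-1 of
    rows with leaders attains it in each term. *)
Lemma jacobi_staircase : [pchar K] =i pred0 ->
  jacobi A = (\sum_i (L i).2)%N.
Proof.
move=> K0; pose t := perm leader_row_inj.
have tE i : t i = (L i).1 by rewrite permE.
have tV i : (L ((t^-1)%g i)).1 = i by rewrite -tE permKV.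
have -> : (\sum_i (L i).2 = \sum_i (L ((t^-1)%g i)).2)%N.
  by rewrite (reindex_inj (@perm_inj _ (t^-1)%g)).
apply/eqP; rewrite eqn_leq; apply/andP; split.
  apply/bigmax_leqP => s _; apply: leq_sum => i _.
  apply/bigmax_leqP_seq => v vA /andP[/eqP vi _].
  by apply: dvars_order_le vA _; rewrite tV.
apply: leq_trans (leq_bigmax (t^-1)%g); apply: leq_sum => i _.
set j := (t^-1)%g i; apply: dord_ge.
have -> : (i, (L j).2) = L j by rewrite [RHS]surjective_pairing tV.
exact/pderiv_neq0/leader_in.
Qed.

Definition low_vars : seq (dvar n) :=
  [seq ((L i).1, r) | i <- enum 'I_n, r <- iota 0 (L i).2].

Lemma size_low_vars : size low_vars = (\sum_i (L i).2)%N.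
Proof.
rewrite size_allpairs_dep sumnE big_map big_enum /=.
by apply: eq_bigr => i _; rewrite size_iota.
Qed.

Lemma low_vars_uniq : uniq low_vars.
Proof.
apply: allpairs_uniq_dep => [|i _|]; [exact: enum_uniq | exact: iota_uniq |].
move=> [i r] [j s] /= _ _ [/leader_row_inj ij rs].
by rewrite ij rs.
Qed.

Lemma low_varsP i r : ((i, r) \in low_vars) =
  [exists j, (i == (L j).1) && (r < (L j).2)%N].
Proof.
apply/allpairsPdep/existsP => [[j [s [_]]]|[j /andP[/eqP -> rj]]].
  rewrite mem_iota add0n => /andP[_ sj] [-> ->].
  by exists j; rewrite eqxx sj.
by exists j, r; rewrite mem_enum mem_iota.
Qed.

Lemma low_varsPn v : v \notin low_vars -> exists j k, v = vder k (L j).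
Proof.
case: v => i r; rewrite low_varsP => /existsPn h.
pose t := perm leader_row_inj; have ti : i = (L ((t^-1)%g i)).1.
  by rewrite -{1}[i](permKV t) permE.
exists ((t^-1)%g i), (r - (L ((t^-1)%g i)).2)%N.
have := h ((t^-1)%g i); rewrite -ti eqxx /= -leqNgt => Lr.
exact: (@vder_fst _ _ (i, r) (esym ti) Lr).
Qed.

Lemma vder_leader_low j k : vder k (L j) \notin low_vars.
Proof.
rewrite low_varsP; apply/existsPn => i; apply/negP => /andP[/eqP /= ij].
by rewrite (leader_row_inj ij) ltnNge leq_addr.
Qed.
End Staircase.

(** * Polynomials in finitely many of the variables *)

Section PolynomialEmbedding.
Variables (K : fieldType) (n d : nat) (v : 'I_d -> dvar n).
Hypothesis v_inj : injective v.
Local Notation R := {dpoly K[n]}.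

Definition embed_monom (m : multinom d) : {cmonom (dvar n)} :=
  \big[mmul/mone]_(k < d) iter (m k) (mmul (ucm (v k))) mone.

Lemma embed_monomE m k : embed_monom m (v k) = m k.
Proof.
have -> : embed_monom m (v k) =
    (\sum_(j < d) iter (m j) (mmul (ucm (v j))) mone (v k))%N.
  exact: (big_morph (fun p : {cmonom (dvar n)} => p (v k)) (cmM _) (cm1 _)).
have E j a : iter a (mmul (ucm (v j))) mone (v k) = (a * (j == k))%N.
  elim: a => [|a IH]; first by rewrite cm1.
  by rewrite iterS cmM IH cmU (inj_eq v_inj).
rewrite (bigD1 k) //= E eqxx muln1 big1 ?addn0 // => j jk.
by rewrite E (negbTE jk) muln0.
Qed.

Lemma embed_monom_inj : injective embed_monom.
Proof. by move=> m m' mm'; apply/mnmP => k; rewrite -!embed_monomE mm'. Qed.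

(** Substitution of the variables v k: through it, a polynomial relation between
    residues of variables becomes an element of P. *)
Definition embed_mpoly (p : mpoly d K) : R :=
  mpoly.mmap (dconst : {rmorphism K -> R}) (fun k => dX K (v k)) p.

Lemma embed_mpolyE p :
  embed_mpoly p =
    \sum_(m <- mpoly.msupp p) << mpoly.mcoeff m p *g embed_monom m >>.
Proof.
apply: eq_bigr => m _.
have -> : mpoly.mmap1 (fun k => dX K (v k)) m = << embed_monom m >>.
  rewrite /embed_monom.
  have UM a b : << mmul a b >> = << a >> * << b >> :> R.
    by apply: etrans (esym (monalgM _ _ _ _)); rewrite mulr1.
  have U1 : << mone >> = 1 :> R by [].
  rewrite (big_morph (fun a : {cmonom (dvar n)} => << a >> : R) UM U1).
  apply: eq_bigr => k _; elim: (m k) => [|a IH]; first by rewrite expr0.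
  by rewrite exprS IH; apply/esym/UM.
by apply: etrans (monalgM _ _ _ _) _; rewrite mulr1 mul1m.
Qed.

Lemma embed_mpoly_eq0 p : embed_mpoly p = 0 -> p = 0.
Proof.
move=> p0; apply/mpolyP => m; rewrite mpoly.mcoeff0.
have [|/memN_msupp_eq0 //] := boolP (m \in mpoly.msupp p) => mp.
have e : (embed_mpoly p)@_(embed_monom m) = 0 by rewrite p0; exact: mcoeff0.
apply: etrans e; rewrite embed_mpolyE mcoeff_sum.
rewrite (bigD1_seq m) ?msupp_uniq //= big1 => [|m' m'm].
  by rewrite addr0; apply/esym/mcoeffUU.
by rewrite mcoeffU (inj_eq embed_monom_inj) (negbTE m'm).
Qed.

Lemma vars_in_embed p : vars_in (fun w => exists k, w = v k) (embed_mpoly p).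
Proof.
rewrite embed_mpolyE; apply: vars_in_sum => m _; apply: vars_inU => w.
rewrite /embed_monom; elim/big_ind: _ => [|a b ha hb|k _].
- by rewrite cm1.
- by rewrite cmM addn_gt0 => /orP[/ha|/hb].
elim: (m k) => [|a IH]; first by rewrite cm1.
rewrite iterS cmM addn_gt0 => /orP[|//]; rewrite cmU.
by case: eqP => // <-; exists k.
Qed.
End PolynomialEmbedding.

Lemma rmorph_mmap (R : nzRingType) (S T : comNzRingType) d
    (f : {rmorphism R -> S}) (g : {rmorphism S -> T}) (h : 'I_d -> S) p :
  mpoly.mmap (g \o f) (g \o h) p = g (mpoly.mmap f h p).
Proof.
rewrite rmorph_sum; apply: eq_bigr => m _; rewrite rmorphM; congr (_ * _).
by rewrite rmorph_prod; apply: eq_bigr => i _; rewrite rmorphXn.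
Qed.

(** * The low variables form a transcendence basis *)

Section TranscendenceBasis.
Variables (K : fieldType) (delta : K -> K) (n : nat).
Variables (P : prime_idealr {dpoly K[n]}) (lt : rel (dvar n)).
Variables (A : n.-tuple {dpoly K[n]}) (L : 'I_n -> dvar n).
Hypotheses (K0 : [pchar K] =i pred0) (deltaP : derivation delta).
Hypotheses (PD : differential_ideal delta P) (ltP : ranking lt).
Hypothesis AP : characteristic_set lt P A.
Hypothesis LP : forall i, leader lt (tnth A i) = Some (L i).
Local Notation R := {dpoly K[n]}.
Local Notation F := {fraction {ideal_quot P}}.
Local Notation res := (residue_frac P).
Local Notation iota := (residue_frac P \o dconst : {rmorphism K -> F}).
Local Notation low := (low_vars L).

Lemma tuple_reduced i j : i != j -> reduced lt (tnth A i) (tnth A j).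
Proof.
case: AP => -[_ _ Ared] _ _ ij; rewrite !(tnth_nth 0).
by apply: Ared; rewrite ?size_tuple.
Qed.

Let Ared := tuple_reduced.

(** A polynomial relation between the residues is an element of P in the low
    variables, where no leader and no derivative of one occurs; it is reduced
    with respect to A, hence zero. *)
Lemma low_vars_indep :
  alg_indep iota (fun k : 'I_(size low) => res (dX K (tnth (in_tuple low) k))).
Proof.
move=> p; rewrite rmorph_mmap => /residue_eq0 fP.
have v_inj : injective (tnth (in_tuple low)).
  apply/tuple_uniqP; exact: (low_vars_uniq ltP LP Ared).
apply: (embed_mpoly_eq0 v_inj); apply: (reduced_mem_eq0 ltP AP fP).
have fl w : w \in dvars (embed_mpoly (tnth (in_tuple low)) p) -> w \in low.
  by move=> /vars_in_embed [k ->]; exact: mem_tnth.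
move=> _ /tnthP [j ->]; rewrite /reduced LP; split=> [k _|].
  by apply/negP => /fl; apply/negP; exact: (vder_leader_low ltP LP Ared).
rewrite degv_eq0 ?degv_gt0 //; first exact: (leader_in ltP LP).
apply/negP => /fl; apply/negP; rewrite -[L j]vder0.
exact: (vder_leader_low ltP LP Ared).
Qed.

(** By induction along the ranking, each variable that is not low is algebraic
    over smaller ones: through A j if it is the leader L j, and through a
    derivative of A j, linear in it, if it is a proper derivative of L j. *)
Lemma low_vars_span (x : F) :
  acl (ext (in_image iota) [seq res (dX K v) | v <- low]) x.
Proof.
set X := ext _ _.
have XK c : acl X (res (dconst c)) by apply: acl_in; left; exists c.
suff XV v : acl X (res (dX K v)).
  have [f [g ->]] := residue_fracP x.
  by apply: acl_div; apply: (acl_residue XK) => v _.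
elim/(ranking_ind ltP): v => v IH.
have [vl|/(low_varsPn ltP LP Ared) [j [k def_v]]] := boolP (v \in low).
  by apply: acl_in; right; apply: map_f.
have [lA lmax] := (leaderP ltP _ _).1 (LP j).
have AjP : tnth A j \in P by case: AP => _ AsubP _; apply/AsubP/mem_tnth.
have SP : pderiv (L j) (tnth A j) \notin P.
  rewrite (tnth_nth 0); apply: (leader_separant ltP AP K0).
    by rewrite size_tuple.
  by rewrite -tnth_nth LP.
case: k def_v => [|k] def_v.
  rewrite def_v vder0 in IH *.
  apply: (acl_leader XK AjP SP) => w /lmax [->|wL]; first by left.
  by right; apply: IH.
have [T TL dA] := iter_dder_leader deltaP ltP k (LP j).
have dP : res (iter k.+1 (dder delta) (tnth A j)) = 0.
  apply/residue_eq0; elim: (k.+1) => [//|h IHh]; rewrite iterS; exact: PD.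
rewrite -def_v in TL dA.
have eq0 : res (pderiv (L j) (tnth A j)) * res (dX K v) + res T = 0.
  by rewrite -residueM -residueD -dA.
have S0 : res (pderiv (L j) (tnth A j)) != 0 by rewrite residue_frac_eq0.
have -> : res (dX K v) = - res T / res (pderiv (L j) (tnth A j)).
  by rewrite -(addr0_eq eq0) opprK mulrC mulKf.
apply: acl_div; first by apply/aclN/(acl_residue XK) => w /TL; exact: IH.
apply: (acl_residue XK) => w.
move=> /(vars_in_pderiv (V := fun w => w \in dvars _) (fun _ => id)).
rewrite def_v in IH; move=> /lmax [->|wL]; apply: IH; first exact: lt_vder.
by apply: (ranking_trans ltP wL); exact: lt_vder.
Qed.

Lemma trdeg_staircase : is_trdeg iota (\sum_i (L i).2)%N.
Proof.
rewrite -(size_low_vars L); split.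
  exists (fun k => res (dX K (tnth (in_tuple low) k))).
  exact: low_vars_indep.
move=> m s sind; rewrite -(size_map (fun v => res (dX K v)) low).
exact: alg_indep_leq sind low_vars_span.
Qed.
End TranscendenceBasis.

Theorem corollary1p8 (K : fieldType) (delta : K -> K) (n : nat)
    (P : prime_idealr {dpoly K[n]}) (lt : rel (dvar n))
    (A : n.-tuple {dpoly K[n]}) :
  [pchar K] =i pred0 ->
  derivation delta ->
  differential_ideal delta P ->
  ranking lt ->
  characteristic_set lt P A ->
  trdeg (residue_frac P \o dconst) = Some (jacobi (tnth A)) /\
  trdeg (residue_frac P \o dconst) <> None.
Proof.
move=> K0 deltaP PD ltP AP.
suff E : trdeg (residue_frac P \o dconst) = Some (jacobi (tnth A)) by rewrite E.
have /choice [L LP] : forall i, exists l, leader lt (tnth A i) = Some l.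
  move=> i; case al: (leader lt (tnth A i)) => [l|]; first by exists l.
  case: AP => -[Anc _ _] _ _; case: (Anc _ (mem_tnth i A)).
  exact/(leader_None ltP).
apply/trdegP; rewrite (jacobi_staircase ltP LP (tuple_reduced AP) K0).
exact: (trdeg_staircase K0 deltaP PD ltP AP LP).
Qed.
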